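(* Let $\Sigma=(B,\sigma)$ be a signed graph whose underlying graph $B$ is a block that is neither a single edge nor a circle, and suppose $[e,C,+]$ is a positive battery and $C$ has exactly two bridges $D_1,D_2$. If both $D_1$ and $D_2$ are paths, then every edge of $D_1\cup D_2$ is a positive battery. Otherwise, no edge of $D_1\cup D_2$ is a positive battery.
   Context: A signed graph $\Sigma=(G,\sigma)$ is a finite graph $G$ with signature $\sigma:E(G)\to\{+,-\}$. A circle is a connected 2-regular subgraph; its sign is the product of its edge signs. A block is a maximal subgraph without a cutpoint. For a circle $C$, a chord is an edge not in $C$ joining two distinct vertices of $C$; a bridge of $C$ is either a chord or a connected component $D$ of $G\setminus V(C)$ together with all edges joining $D$ to $C$ (a bridge ''is a path'' if as a subgraph it is a path). An edge $f$ is a positive battery if it lies in exactly one positive circle; $[e,C,+]$ means $C$ is a positive circle containing $e$ and is the only positive circle containing $e$. *)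

(* Defs.v *)
(* Signed (multi)graphs: vertex type V, edge type E,
   each edge e has ends ends1 e, ends2 e (loops allowed when equal).
   Subgraphs are represented by their edge sets. *)
From mathcomp Require Import all_boot.
Set Implicit Arguments. Unset Strict Implicit. Unset Printing Implicit Defensive.

Section SignedGraph.
Variables (V E : finType) (ends1 ends2 : E -> V).

Definition inc (e : E) (v : V) : bool := (ends1 e == v) || (ends2 e == v).

Definition vset (S : {set E}) : {set V} := [set v | [exists e in S, inc e v]].

(* degree of v in the subgraph S (a loop counts twice) *)
Definition deg (S : {set E}) (v : V) : nat :=
  \sum_(e in S) ((ends1 e == v) + (ends2 e == v)).

Definition eadj (S : {set E}) : rel E :=
  [rel e f | [&& e \in S, f \in S & [exists v, inc e v && inc f v]]].

Definition connected_eset (S : {set E}) : bool :=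
  [forall e in S, forall f in S, connect (eadj S) e f].

Definition is_circle (S : {set E}) : bool :=
  [&& S != set0, connected_eset S & [forall v, (deg S v == 0) || (deg S v == 2)]].

Definition is_path (P : {set E}) : bool :=
  [&& P != set0, connected_eset P, [forall v, deg P v <= 2]
    & [forall Q : {set E}, (Q \subset P) ==> ~~ is_circle Q]].

Definition vadj : rel V :=
  [rel u v | [exists e, ((ends1 e == u) && (ends2 e == v))
                     || ((ends1 e == v) && (ends2 e == u))]].

Definition gconnected : Prop := forall u v : V, connect vadj u v.

Definition cutpoint (v : V) : Prop :=
  exists E1 : {set E},
    [/\ E1 != set0, E1 != setT & vset E1 :&: vset (~: E1) \subset [set v]].

Definition is_block : Prop := gconnected /\ forall v, ~ cutpoint v.

Definition chord (C : {set E}) (f : E) : bool :=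
  [&& f \notin C, ends1 f != ends2 f, ends1 f \in vset C & ends2 f \in vset C].

Definition outadj (C : {set E}) : rel V :=
  [rel u v | [&& u \notin vset C, v \notin vset C & vadj u v]].

(* edge set of the bridge formed by the component of G \ V(C) containing x
   together with all edges joining it to C *)
Definition comp_bridge (C : {set E}) (x : V) : {set E} :=
  [set f | [exists u, [&& inc f u, u \notin vset C & connect (outadj C) x u]]].

Definition is_bridge (C D : {set E}) : Prop :=
  (exists2 f, chord C f & D = [set f]) \/
  (exists2 x, x \notin vset C & D = comp_bridge C x).

(* signature: sigma e = true means e is positive *)
Variable sigma : E -> bool.

(* sign of S is the product of its edge signs: positive iff
   an even number of negative edges *)
Definition positive (S : {set E}) : bool := ~~ odd #|[set e in S | ~~ sigma e]|.

Definition pos_circle (S : {set E}) : bool := is_circle S && positive S.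

Definition pos_battery (f : E) : bool := #|[set C | pos_circle C && (f \in C)]| == 1.

Definition battery_circle (e : E) (C : {set E}) : Prop :=
  [/\ pos_circle C, e \in C &
      forall C' : {set E}, pos_circle C' -> e \in C' -> C' = C].

End SignedGraph.

(* Main.v *)
(* Circles are the minimal nonempty sets of the cycle space over F_2 (edge
   sets all of whose degrees are even), signs are additive on it, and in a
   block the bridges of [C] are the components of the contraction by [C]. Let
   an ear be an even set [X] whose trace outside [C] is minimal and whose
   trace on [C] is neither empty nor [C]: one of [X], [X + C] is a circle
   through [e] other than [C], so [X] is negative. Two ears [X1], [X2] from
   different bridges therefore have a positive sum, and the one of [X1 + X2],
   [X1 + X2 + C] avoiding [e] is a positive circle. When both bridges are
   paths, each has only one ear and this circle is the only positive one
   besides [C]. Otherwise there is an edge [g] outside [C], [X1] and [X2], and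
   a circle through [g] that adds as few edges as possible to these sets gives
   a second positive circle through any given edge outside [C]. *)
Require Import Defs.
From mathcomp Require Import all_boot.
Set Implicit Arguments. Unset Strict Implicit. Unset Printing Implicit Defensive.

(** Set identities are proved pointwise: the membership facts are moved into the goal as Booleans,
    and every atom is split. *)
Ltac memcase :=
  repeat match goal with |- context [in_mem ?x (mem ?A)] => case: (x \in A) end; done.

(** * Symmetric difference, the addition of the cycle space *)

Section SymmetricDifference.
Variable T : finType.
Implicit Types A B C : {set T}.

Definition symd A B := [set x | (x \in A) (+) (x \in B)].

Lemma in_symd A B x : (x \in symd A B) = (x \in A) (+) (x \in B).
Proof. by rewrite inE. Qed.

(** Inclusion as a Boolean implication, the form that [memcase] can split. *)
Lemma sub_in A B x : A \subset B -> (x \in A) ==> (x \in B).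
Proof. by move=> /subsetP sAB; apply/implyP/sAB. Qed.

Lemma odd_sum_symd (w : T -> nat) A B :
  odd (\sum_(x in symd A B) w x) =
  odd (\sum_(x in A) w x) (+) odd (\sum_(x in B) w x).
Proof.
have oddE S : odd (\sum_(x in S) w x) =
    \big[addb/false]_x ((x \in S) && odd (w x)).
  rewrite (big_morph odd oddD (erefl : odd 0 = false)) big_mkcond.
  by apply: eq_bigr => x _; case: ifP.
rewrite !oddE -big_split; apply: eq_bigr => x _ /=.
by rewrite in_symd; do 2!case: (x \in _); case: (odd _).
Qed.

End SymmetricDifference.

Lemma connect_inv (T : finType) (r : rel T) (P : T -> Prop) x y :
  (forall a b, r a b -> P a -> P b) -> P x -> connect r x y -> P y.
Proof.
move=> Pr Px /connectP[p + ->]; elim: p x Px => //= z p IHp x Px /andP[rxz].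
exact/IHp/(Pr x).
Qed.

(** * Degrees and even edge sets *)

Section CycleSpace.
Variables (V E : finType) (ends1 ends2 : E -> V).
Implicit Types (S X Y Z A P : {set E}) (f g : E) (u v w : V).

Local Notation inc := (inc ends1 ends2).
Local Notation vset := (vset ends1 ends2).
Local Notation deg := (deg ends1 ends2).
Local Notation eadj := (eadj ends1 ends2).
Local Notation connected_eset := (connected_eset ends1 ends2).
Local Notation is_circle := (is_circle ends1 ends2).
Local Notation is_path := (is_path ends1 ends2).

Definition even_eset S := [forall v, ~~ odd (deg S v)].

Lemma even_esetP S : reflect (forall v, odd (deg S v) = false) (even_eset S).
Proof. by apply: (iffP forallP) => oS v; [apply/negbTE | rewrite oS]. Qed.

Lemma odd_deg_symd X Y v : odd (deg (symd X Y) v) = odd (deg X v) (+) odd (deg Y v).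
Proof. exact: odd_sum_symd. Qed.

Lemma even_symd X Y : even_eset X -> even_eset Y -> even_eset (symd X Y).
Proof.
by move=> /even_esetP eX /even_esetP eY; apply/even_esetP=> v; rewrite odd_deg_symd eX eY.
Qed.

Lemma deg0 v : deg set0 v = 0.
Proof. by rewrite /Defs.deg big_set0. Qed.

Lemma deg1 f v : deg [set f] v = (ends1 f == v) + (ends2 f == v).
Proof. by rewrite /Defs.deg big_set1. Qed.

Lemma deg_split X Y v : Y \subset X -> deg X v = deg Y v + deg (X :\: Y) v.
Proof.
move=> sYX; rewrite /Defs.deg (big_setID Y) /=.
by congr (_ + _); apply: eq_bigl => f; rewrite (setIidPr sYX).
Qed.

Lemma vsetP S v : reflect (exists2 f, f \in S & inc f v) (v \in vset S).
Proof. by rewrite inE; apply: (iffP exists_inP) => -[f fS fv]; exists f. Qed.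

Lemma deg_gt0 S v : (0 < deg S v) = (v \in vset S).
Proof.
rewrite lt0n /Defs.deg sum_nat_eq0 negb_forall; apply/existsP/vsetP.
  move=> [f]; rewrite negb_imply => /andP[fS]; rewrite addn_eq0 !eqb0 negb_and !negbK.
  by exists f.
by move=> [f fS fv]; exists f; rewrite negb_imply fS /= addn_eq0 !eqb0 negb_and !negbK.
Qed.

Lemma inc1 f : inc f (ends1 f). Proof. by rewrite /Defs.inc eqxx. Qed.
Lemma inc2 f : inc f (ends2 f). Proof. by rewrite /Defs.inc eqxx orbT. Qed.

Lemma vset_inc S f v : f \in S -> inc f v -> v \in vset S.
Proof. by move=> fS fv; apply/vsetP; exists f. Qed.

(** One edge of [A] at [v] draws in every edge of [S] at [v]. Components and bridges thus inherit
    the parity of [S] wherever they are closed. *)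
Lemma deg_part S A v : A \subset S ->
  (forall f g, f \in A -> g \in S -> inc f v -> inc g v -> g \in A) ->
  deg A v = deg S v \/ deg A v = 0.
Proof.
move=> sAS cA; case: (posnP (deg A v)); first by right.
rewrite deg_gt0 => /vsetP[f fA fv]; left.
rewrite (deg_split v sAS); apply/eqP; rewrite -{1}[deg A v]addn0 eqn_add2l eq_sym eqn0Ngt.
rewrite deg_gt0; apply/vsetP => -[g]; rewrite inE => /andP[gA gS gv].
by rewrite (cA f g) in gA.
Qed.

(** * Joins *)

(** A T-join with T = {u, v}. It stands in for a path from [u] to [v], and is an even set when
    [u = v]. *)
Definition is_join P u v := [forall w, odd (deg P w) == ((w == u) (+) (w == v))].

Definition joined S u v := [exists P : {set E}, (P \subset S) && is_join P u v].

Lemma is_joinP P u v :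
  reflect (forall w, odd (deg P w) = (w == u) (+) (w == v)) (is_join P u v).
Proof. by apply: (iffP forallP) => jP w; apply/eqP. Qed.

Lemma joinedP S u v : reflect (exists2 P : {set E}, P \subset S & is_join P u v) (joined S u v).
Proof.
apply: (iffP existsP) => [[P /andP[]]|[P sP jP]]; first by exists P.
by exists P; rewrite sP.
Qed.

Lemma joined_refl S u : joined S u u.
Proof.
apply/joinedP; exists set0; first exact: sub0set.
by apply/is_joinP => w; rewrite deg0 addbb.
Qed.

Lemma joined_sym S u v : joined S u v -> joined S v u.
Proof.
move=> /joinedP[P sP /is_joinP jP]; apply/joinedP; exists P => //.
by apply/is_joinP => w; rewrite jP addbC.
Qed.

Lemma symd_sub X Y S : X \subset S -> Y \subset S -> symd X Y \subset S.
Proof.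
move=> sX sY; apply/subsetP => x; rewrite in_symd.
move: (sub_in x sX) (sub_in x sY); memcase.
Qed.

Lemma joined_trans S u v w : joined S u v -> joined S v w -> joined S u w.
Proof.
move=> /joinedP[P sP /is_joinP jP] /joinedP[Q sQ /is_joinP jQ].
apply/joinedP; exists (symd P Q); first exact: symd_sub.
apply/is_joinP => z; rewrite odd_deg_symd jP jQ.
by do 3!case: (z == _).
Qed.

Lemma joined_mono S S' u v : S \subset S' -> joined S u v -> joined S' u v.
Proof.
move=> sS /joinedP[P sP jP]; apply/joinedP; exists P => //.
exact: subset_trans sS.
Qed.

Lemma joined_edge S f u v : f \in S -> inc f u -> inc f v -> joined S u v.
Proof.
move=> fS; have je : joined S (ends1 f) (ends2 f).
  apply/joinedP; exists [set f]; first by rewrite sub1set.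
  by apply/is_joinP => w; rewrite deg1 oddD !oddb !(eq_sym w).
by move=> /orP[]/eqP<- /orP[]/eqP<-; rewrite ?joined_refl ?je ?(joined_sym je).
Qed.

(** Along a chain of adjacent edges, [u] stays joined to some end of the current edge. *)
Lemma connected_joined S u v :
  connected_eset S -> u \in vset S -> v \in vset S -> joined S u v.
Proof.
move=> /forall_inP cS /vsetP[f fS fu] /vsetP[g gS gv].
have/forall_inP/(_ g gS) cfg := cS f fS.
suff [w gw juw] : exists2 w, inc g w & joined S u w.
  exact/(joined_trans juw)/(joined_edge gS).
apply: (connect_inv (r := eadj S) (P := fun h => exists2 w, inc h w & joined S u w)) cfg.
  move=> a b /and3P[aS bS /existsP[x /andP[ax bx]]] [w aw juw].
  by exists x => //; apply: (joined_trans juw); apply: joined_edge ax.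
by exists u => //; apply: joined_refl.
Qed.

Lemma handshake S : ~~ odd (\sum_v deg S v).
Proof.
rewrite /Defs.deg exchange_big /=.
have -> : \sum_(f in S) \sum_v ((ends1 f == v) + (ends2 f == v)) = \sum_(f in S) 2.
  apply: eq_bigr => f _; rewrite big_split /=.
  have one w : \sum_v (w == v) = 1.
    by rewrite (bigD1 w) //= eqxx big1 // => v; rewrite eq_sym => /negbTE->.
  by rewrite !one.
by rewrite sum_nat_const oddM andbF.
Qed.

(** The handshake lemma is applied to the component [K] of [u] in [S], where degrees agree with
    those of [S]. *)
Lemma odd_partner S u : odd (deg S u) ->
  exists v, [/\ v != u, odd (deg S v) & joined S u v].
Proof.
move=> odu; pose K := [set f in S | joined S u (ends1 f)].
have sKS : K \subset S by apply/subsetP => f; rewrite inE => /andP[].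
have KI f v : f \in S -> inc f v -> (f \in K) = joined S u v.
  move=> fS fv; rewrite inE fS /=.
  by apply/idP/idP => /joined_trans; apply; apply: joined_edge fS _ _ => //; apply: inc1.
have degK v : odd (deg K v) -> odd (deg S v) /\ joined S u v.
  move=> oK; have: v \in vset K by rewrite -deg_gt0 odd_gt0.
  move=> /vsetP[f fK fv]; have fS := subsetP sKS _ fK.
  have juv : joined S u v by rewrite -(KI _ _ fS fv).
  split=> //; case: (@deg_part S K v sKS) => [g h gK hS gv hv|<-//|d0].
    by rewrite (KI _ _ hS hv).
  by rewrite d0 in oK.
have oKu : odd (deg K u).
  case: (@deg_part S K u sKS) => [g h gK hS gv hv|->//|d0].
    by rewrite (KI _ _ hS hv) joined_refl.
  have: u \in vset S by rewrite -deg_gt0 odd_gt0.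
  move=> /vsetP[f fS fu]; suff: 0 < deg K u by rewrite d0.
  by rewrite deg_gt0; apply: (vset_inc _ fu); rewrite (KI _ _ fS fu) joined_refl.
have [/existsP[v /andP[vu /degK[oSv juv]]]|] :=
  boolP [exists v, (v != u) && odd (deg K v)]; first by exists v.
rewrite negb_exists => /forallP noK; have := handshake K.
rewrite (bigD1 u) //= oddD oKu /= negbK => /negP; case.
rewrite (big_morph odd oddD (erefl : odd 0 = false)) big1 // => v vu.
by have := noK v; rewrite vu => /negbTE.
Qed.

(** Induction on the number of odd vertices: a join inside [C] between two of them makes both even
    and leaves the other parities unchanged. *)
Lemma complete_even C Y : connected_eset C ->
  (forall v, odd (deg Y v) -> v \in vset C) ->
  exists2 A : {set E}, A \subset C & even_eset (symd Y A).
Proof.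
move=> cC; have [n] := ubnP #|[set v | odd (deg Y v)]|.
elim: n Y => // n IHn Y leY oY.
have [/existsP[u ou]|] := boolP [exists v, odd (deg Y v)]; last first.
  rewrite negb_exists => /forallP eY; exists set0; first exact: sub0set.
  by apply/even_esetP => v; rewrite odd_deg_symd deg0 addbF; apply/negbTE.
have [v [vu ov _]] := odd_partner ou.
have /joinedP[P sPC /is_joinP jP] := connected_joined cC (oY u ou) (oY v ov).
have odE w : odd (deg (symd Y P) w) = [&& odd (deg Y w), w != u & w != v].
  rewrite odd_deg_symd jP; case: (eqVneq w u) => [->|_].
    by rewrite ou eq_sym (negbTE vu).
  by case: (eqVneq w v) => [->|]; rewrite ?ov ?andbT ?addbF.
have [||A sAC eA] := IHn (symd Y P).
- apply: leq_trans (_ : #|[set w | odd (deg Y w)]| <= n) => //.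
  apply: proper_card; apply/properP; split.
    by apply/subsetP => w; rewrite !inE odE => /and3P[].
  by exists u; rewrite !inE // odE eqxx andbF.
- by move=> w; rewrite odE => /and3P[/oY].
exists (symd P A); first exact: symd_sub.
apply/even_esetP => w; move/even_esetP/(_ w): eA.
by rewrite !odd_deg_symd addbA.
Qed.

(** * Circles as minimal nonempty even sets *)

Lemma circle_connected S : is_circle S -> connected_eset S.
Proof. by case/and3P. Qed.

Lemma circle_neq0 S : is_circle S -> S != set0.
Proof. by case/and3P. Qed.

Lemma circle_deg S v : is_circle S -> deg S v <= 2.
Proof. by case/and3P=> _ _ /forallP/(_ v)/orP[]/eqP->. Qed.

Lemma circle_even S : is_circle S -> even_eset S.
Proof.
by case/and3P=> _ _ /forallP dS; apply/even_esetP => v; case/orP: (dS v) => /eqP->.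
Qed.

(** At a vertex of degree 2 an even subset takes both edges or none, so connectedness spreads [Y]
    over all of [S]. *)
Lemma circle_min S Y : is_circle S -> even_eset Y -> Y \subset S -> Y != set0 -> Y = S.
Proof.
move=> cS /even_esetP eY sYS /set0Pn[f fY]; apply/eqP; rewrite eqEsubset sYS /=.
apply/subsetP => g gS; have fS := subsetP sYS _ fY.
have /forall_inP/(_ f fS)/forall_inP/(_ g gS) := circle_connected cS.
apply: (connect_inv (P := fun g => g \in Y)) fY => a b /and3P[aS bS /existsP[v /andP[av bv]]] aY.
apply/negPn/negP => bY.
have: 0 < deg Y v by rewrite deg_gt0; apply: vset_inc av.
have: 0 < deg (S :\: Y) v by rewrite deg_gt0; apply: vset_inc bv; rewrite inE bY.
have := circle_deg v cS; rewrite (deg_split v sYS).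
by have := eY v; case: (deg Y v) => [|[|[|?]]] //; case: (deg (S :\: Y) v).
Qed.

Lemma deg_edge f u v w : inc f u -> inc f v -> u != v ->
  deg [set f] w = (w == u) + (w == v).
Proof.
rewrite deg1 !(eq_sym w) => /orP[]/eqP<- /orP[]/eqP<- //; rewrite ?eqxx //.
by rewrite addnC.
Qed.

(* If three edges of [Y] met at [v], then two of them would be linked by a join
   avoiding [v], and close up to a smaller even set. *)
Lemma min_even_deg2 Y v : even_eset Y ->
  (forall Z, even_eset Z -> Z \subset Y -> Z != set0 -> Z = Y) ->
  deg Y v <= 2.
Proof.
move=> /even_esetP eY minY; rewrite leqNgt; apply/negP => dv.
(* A loop is an even set by itself, so it would be all of [Y] and give degree only 2. *)
have noloop f : f \in Y -> inc f v -> exists2 w, inc f w & w != v.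
  move=> fY fv; have [/andP[/eqP e1 /eqP e2]|] := boolP ((ends1 f == v) && (ends2 f == v)).
    have Y1 : [set f] = Y.
      apply: minY; rewrite ?sub1set //; last by apply/set0Pn; exists f; rewrite inE.
      by apply/even_esetP => w; rewrite deg1 e1 e2 oddD addbb.
    by move: dv; rewrite -Y1 deg1 e1 e2 eqxx.
  rewrite negb_and => /orP[]; first by exists (ends1 f); rewrite ?inc1.
  by exists (ends2 f); rewrite ?inc2.
pose N := [set f in Y | inc f v]; pose Y' := Y :\: N.
have sNY : N \subset Y by apply/subsetP => f; rewrite inE => /andP[].
(* As [Y] is even, [N] and its complement [Y'] in [Y] have the same odd vertices. *)
have oN w : odd (deg Y' w) = odd (deg N w).
  by have := eY w; rewrite (deg_split w sNY) oddD; do 2!case: (odd _).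
have Y'v : deg Y' v = 0.
  apply/eqP; rewrite eqn0Ngt deg_gt0; apply/vsetP => -[f].
  by rewrite !inE => /andP[/nandP[/negP|/negP]].
have /vsetP[f fY fv] : v \in vset Y by rewrite -deg_gt0; apply: leq_trans dv.
have [w fw wv] := noloop f fY fv; have vw : v != w by rewrite eq_sym.
have fN : f \in N by rewrite inE fY.
suff [g [gN gf [w' [gw' w'v /joinedP[P sP /is_joinP jP]]]]] : exists g, [/\ g \in N, g != f &
    exists w', [/\ inc g w', w' != v & joined Y' w w']].
  have vw' : v != w' by rewrite eq_sym.
  have [gY gv] : g \in Y /\ inc g v by move: gN; rewrite inE => /andP[].
  have [/(subset_trans sP) sPY PN] : Y' \subset Y /\ forall h, h \in P -> h \notin N.
    split=> [|h /(subsetP sP)]; first exact: subsetDl.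
    by rewrite inE => /andP[].
  pose Z := symd P (symd [set f] [set g]).
  have ZY : Z = Y.
    apply: minY.
    - apply/even_esetP => x; rewrite !odd_deg_symd jP (deg_edge _ fv fw) //.
      rewrite (deg_edge _ gv gw') // !oddD !oddb.
      by do 3!case: (x == _).
    - by rewrite !symd_sub ?sub1set.
    - apply/set0Pn; exists f; rewrite !in_symd !inE eqxx eq_sym (negbTE gf).
      by rewrite /= addbT; apply: contraL fN; apply: PN.
  (* [f] and [g] use only two of the at least three units of degree at [v]. A third edge [h] at [v]
     belongs to [N], hence not to [P], so [Z] misses it although [Z = Y]. *)
  have: 0 < deg (Y :\ f :\ g) v.
    move: dv; rewrite (@deg_split Y [set f]) ?sub1set //.
    rewrite (@deg_split (Y :\ f) [set g]) ?sub1set ?inE ?gf //.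
    rewrite (deg_edge _ fv fw) // (deg_edge _ gv gw') // eqxx.
    by rewrite (negbTE vw) (negbTE vw').
  rewrite deg_gt0 => /vsetP[h]; rewrite !inE => /and3P[hg hf hY] hv.
  move: (hY); rewrite -{1}ZY !in_symd !inE (negbTE hg) (negbTE hf) /= addbF => /PN.
  by rewrite inE hY hv.
(* If [w] is odd in [Y'], its partner there is the far end of another edge of [N]. Otherwise [N] has
   a second edge at [w], parallel to [f], and the empty join suffices. *)
have [oNw|eNw] := boolP (odd (deg N w)).
  have [|w' [w'w ow' jw]] := @odd_partner Y' w; first by rewrite oN.
  have /vsetP[g gN gw'] : w' \in vset N by rewrite -deg_gt0 odd_gt0 -?oN.
  have w'v : w' != v by apply: contraTneq ow' => ->; rewrite Y'v.
  exists g; split=> //; last by exists w'.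
  apply: contraTneq gw' => ->; apply/negP => fw'.
  have := deg_edge w' fv fw vw.
  rewrite (negbTE w'v) (negbTE w'w) => /eqP; rewrite eqn0Ngt deg_gt0.
  by rewrite (vset_inc _ fw') ?inE.
have : 0 < deg (N :\ f) w.
  move: eNw; rewrite (@deg_split N [set f]) ?sub1set //.
  by rewrite (deg_edge _ fv fw) // eqxx (negbTE wv) negbK; apply: odd_gt0.
rewrite deg_gt0 => /vsetP[g]; rewrite inE => /andP[]; rewrite inE => gf gN gw.
by exists g; split=> //; exists w; rewrite joined_refl.
Qed.

(** The degree bound is [min_even_deg2]; connectedness holds because a component of an even set is
    even. *)
Lemma min_even_circle Y : even_eset Y -> Y != set0 ->
  (forall Z, even_eset Z -> Z \subset Y -> Z != set0 -> Z = Y) -> is_circle Y.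
Proof.
move=> eY Y0 minY; apply/and3P; split => //; last first.
  apply/forallP => v; have := min_even_deg2 v eY minY.
  by move/even_esetP/(_ v): eY; case: (deg Y v) => [|[|[|?]]].
apply/forall_inP => f fY; apply/forall_inP => g gY.
pose K := [set h in Y | connect (eadj Y) f h].
suff /setP/(_ g) : K = Y by rewrite inE gY.
have sKY : K \subset Y by apply/subsetP => h; rewrite inE => /andP[].
apply: minY => //; last by apply/set0Pn; exists f; rewrite inE fY connect0.
apply/even_esetP => v; case: (@deg_part Y K v sKY) => [a b|->|->//]; last first.
  exact/even_esetP.
rewrite inE => /andP[aY fa] bY av bv; rewrite inE bY.
apply: connect_trans fa (connect1 _).
by apply/and3P; split=> //; apply/existsP; exists v; rewrite av.
Qed.

(** A smallest even subset through [f] is minimal among all nonempty even sets: a smaller [W]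
    avoiding [f] could be subtracted from it. *)
Lemma even_circle Y f : even_eset Y -> f \in Y ->
  exists Z, [/\ is_circle Z, Z \subset Y & f \in Z].
Proof.
move=> eY fY; pose Q (Z : {set E}) := [&& even_eset Z, Z \subset Y & f \in Z].
have QY : Q Y by rewrite /Q eY subxx.
case: (arg_minnP (fun Z : {set E} => #|Z|) QY) => Z /and3P[eZ sZY fZ] minZ.
exists Z; split=> //; apply: min_even_circle => //; first by apply/set0Pn; exists f.
move=> W eW sWZ W0; apply/eqP; rewrite eqEcard sWZ /=.
have [fW|fW] := boolP (f \in W).
  by apply: minZ; rewrite /Q eW fW (subset_trans sWZ).
have: #|Z| <= #|symd Z W|.
  by apply: minZ; rewrite /Q even_symd // in_symd fZ (negbTE fW) symd_sub ?(subset_trans sWZ).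
have -> : symd Z W = Z :\: W.
  apply/setP => x; move: (sub_in x sWZ); rewrite in_symd inE; memcase.
rewrite cardsD (setIidPr sWZ) leqNgt ltn_subrL card_gt0 W0 card_gt0.
by have -> : Z != set0 by apply/set0Pn; exists f.
Qed.

(** * Blocks *)

(** Induction on the size of the union: if the circle [Z1] through [a] inside [symd X Y] misses [b],
    it takes the place of [X]. *)
Lemma circle_trans X Y a b : is_circle X -> is_circle Y -> X :&: Y != set0 ->
  a \in X -> b \in Y -> exists Z, [/\ is_circle Z, a \in Z & b \in Z].
Proof.
have [n] := ubnP #|X :|: Y|; elim: n X => // n IHn X leXY cX cY XY0 aX bY.
have [aY|aY] := boolP (a \in Y); first by exists Y.
have [bX|bX] := boolP (b \in X); first by exists X.
have [c] := set0Pn _ XY0; rewrite inE => /andP[cX' cY'].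
have eXY : even_eset (symd X Y) by rewrite even_symd ?circle_even.
have [|Z1 [cZ1 sZ1 aZ1]] := even_circle (f := a) eXY; first by rewrite in_symd aX (negbTE aY).
have [bZ1|bZ1] := boolP (b \in Z1); first by exists Z1.
have cNZ1 : c \notin Z1.
  by apply/negP => /(subsetP sZ1); rewrite in_symd cX' cY'.
have [||Z2 [cZ2 sZ2 bZ2]] := @even_circle (symd (symd X Y) Z1) b.
- exact: even_symd eXY (circle_even cZ1).
- by rewrite !in_symd (negbTE bX) bY (negbTE bZ1).
have cNZ2 : c \notin Z2.
  by apply/negP => /(subsetP sZ2); rewrite !in_symd cX' cY' (negbTE cNZ1).
(* [Z2] avoids [c], so it is not inside [Y]. Its edge [x] outside [Y] lies in [X] but not in [Z1],
   which makes [Z1 :|: Y] smaller than [X :|: Y]. *)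
have sZ2X : ~~ (Z2 \subset Y).
  apply/negP => sZ2Y; move: cNZ2.
  by rewrite (circle_min cY (circle_even cZ2) sZ2Y (circle_neq0 cZ2)) cY'.
have [x xZ2 xY] := subsetPn sZ2X.
apply: (IHn Z1) => //.
  apply: leq_trans (_ : #|X :|: Y| <= n) => //; apply: proper_card; apply/properP; split.
    apply/subsetP => y; move: (sub_in y sZ1); rewrite !inE; memcase.
  by exists x; move: (sub_in x sZ1) (sub_in x sZ2); rewrite !inE xZ2 (negbTE xY); memcase.
apply: contraNneq cNZ1 => Z1Y0.
have sZ1X : Z1 \subset X.
  apply/subsetP => y; move: (sub_in y sZ1) (in_set0 y); rewrite -Z1Y0 !inE; memcase.
by rewrite (circle_min cX (circle_even cZ1) sZ1X (circle_neq0 cZ1)).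
Qed.

Hypothesis block : is_block ends1 ends2.

Lemma block_two_vertices S : S != set0 -> S != setT ->
  exists u v, [/\ u != v, u \in vset S :&: vset (~: S) & v \in vset S :&: vset (~: S)].
Proof.
move=> S0 ST; case: block => _ ncut.
have nsub v : ~~ (vset S :&: vset (~: S) \subset [set v]).
  by apply/negP => sv; apply: (ncut v); exists S.
have [f _] := set0Pn _ S0.
(* [ends1 f] is an arbitrary vertex here: it only serves to show that the boundary is nonempty. *)
have /subsetPn[u uS _] := nsub (ends1 f).
have /subsetPn[v vS] := nsub u.
by rewrite inE => vu; exists v, u.
Qed.

Lemma block_no_loop f g : f != g -> ends1 f != ends2 f.
Proof.
move=> fg; apply/eqP => ff.
have [||u [v []]] := @block_two_vertices [set f].
- by apply/set0Pn; exists f; rewrite inE.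
- by apply: contraNneq fg => fT; rewrite eq_sym -in_set1 fT inE.
have uf w : w \in vset [set f] -> w = ends1 f.
  by move=> /vsetP[h]; rewrite inE => /eqP-> /orP[]/eqP<-.
by move=> uv /setIP[/uf u1 _] /setIP[/uf v1 _]; rewrite u1 v1 eqxx in uv.
Qed.

(** Let [E1] be the class of [a] for lying on a common circle. A component [W] of the remaining
    edges would meet [E1] in two vertices, and a join through each side would produce a circle
    leaving [E1]. *)
Lemma block_common_circle a b : a != b ->
  exists Z, [/\ is_circle Z, a \in Z & b \in Z].
Proof.
move=> ab; pose R : rel E :=
  fun f g => [exists Z : {set E}, [&& is_circle Z, f \in Z & g \in Z]].
have RP f g : reflect (exists Z, [/\ is_circle Z, f \in Z & g \in Z]) (R f g).
  by apply: (iffP existsP) => -[Z /and3P ZP]; exists Z.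
pose E1 := [set g | connect R a g].
have aE1 : a \in E1 by rewrite inE connect0.
have E1step f g : f \in E1 -> R f g -> g \in E1.
  by rewrite !inE => cf fg; apply: connect_trans cf (connect1 fg).
suff E1T : E1 = setT.
  have : connect R a b by have := in_setT b; rewrite -E1T inE.
  (* [R] is reflexive only at edges that lie on a circle, hence the separate case [a = c]. *)
  suff H c : connect R a c -> a = c \/ R a c.
    by case/H => [/eqP|/RP//]; rewrite (negbTE ab).
  apply: (connect_inv (P := fun c => a = c \/ R a c)); last by left.
  move=> f g fg [->|/RP[Z [cZ aZ fZ]]]; right=> //; case/RP: fg => Y [cY fY gY].
  by apply/RP/(circle_trans cZ cY) => //; apply/set0Pn; exists f; rewrite inE fZ.
apply/setP => g0; rewrite in_setT; apply/negPn/negP => g0E1.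
pose W := [set g | (g \notin E1) && joined (~: E1) (ends1 g0) (ends1 g)].
have WI g v : g \notin E1 -> inc g v -> (g \in W) = joined (~: E1) (ends1 g0) v.
  move=> gE1 gv; rewrite inE gE1 /=; have gE1' : g \in ~: E1 by rewrite inE.
  by apply/idP/idP => /joined_trans; apply; apply: joined_edge gE1' _ _ => //; apply: inc1.
have [||u [v [uv uI vI]]] := @block_two_vertices W.
- by apply/set0Pn; exists g0; rewrite (WI _ (ends1 g0)) ?joined_refl ?inc1.
- by apply: contraTneq aE1 => WT; have := in_setT a; rewrite -WT inE => /andP[].
(* An edge outside [E1] at a vertex of [W] belongs to [W], so the boundary of [W] lies on [E1]. *)
have inW w : w \in vset W :&: vset (~: W) -> w \in vset E1 /\ joined (~: E1) (ends1 g0) w.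
  move=> /setIP[/vsetP[g gW gw] /vsetP[h]]; rewrite inE => hW hw.
  have gE1 : g \notin E1 by move: gW; rewrite inE => /andP[].
  have jw : joined (~: E1) (ends1 g0) w by rewrite -(WI g).
  split=> //; apply: (vset_inc _ hw); apply: contraNT hW => hE1.
  by rewrite (WI _ w).
have [uE1 ju] := inW u uI; have [vE1 jv] := inW v vI.
have jW : joined (~: E1) u v by apply: joined_trans (joined_sym ju) jv.
have jE1 w : w \in vset E1 -> joined E1 (ends1 a) w.
  move=> /vsetP[g gE1 gw]; apply: joined_trans (joined_edge gE1 (inc1 _) gw).
  have: connect R a g by move: gE1; rewrite inE.
  suff H k : connect R a k -> k \in E1 /\ joined E1 (ends1 a) (ends1 k) by case/H.
  apply: (connect_inv (P := fun k => k \in E1 /\ joined E1 (ends1 a) (ends1 k))).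
    move=> f k' fk [fE1 jf]; split; first exact: E1step fk.
    case/RP: fk => Z [cZ fZ kZ]; apply: (joined_trans jf).
    have sZ : Z \subset E1.
      by apply/subsetP => l lZ; apply: (E1step f) => //; apply/RP; exists Z.
    apply: (joined_mono sZ); apply: connected_joined (circle_connected cZ) _ _.
      exact: vset_inc fZ (inc1 _).
    exact: vset_inc kZ (inc1 _).
  by rewrite joined_refl.
have [Q sQ /is_joinP jQ] := joinedP _ _ _ (joined_trans (joined_sym (jE1 u uE1)) (jE1 v vE1)).
pose isP (P : {set E}) := (P \subset ~: E1) && is_join P u v.
have [P0 sP0 jP0] := joinedP _ _ _ jW.
have isP0 : isP P0 by rewrite /isP sP0.
(* For a smallest join [P] outside [E1], a circle in [symd P Q] through an edge of [P] cannot use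
   [E1]. It therefore lies in [P], and removing it leaves a smaller join. *)
case: (arg_minnP (fun P : {set E} => #|P|) isP0) => P /andP[sP jP] minP.
move/is_joinP: (jP) => jP'.
have /vsetP[p pP _] : u \in vset P by rewrite -deg_gt0 odd_gt0 // jP' eqxx (negbTE uv).
have pNE1 : p \notin E1 by have := subsetP sP _ pP; rewrite inE.
have [||Y [cY sY pY]] := @even_circle (symd P Q) p.
- by apply/even_esetP => w; rewrite odd_deg_symd jP' jQ addbb.
- rewrite in_symd pP; move: (sub_in p sQ); rewrite (negbTE pNE1); memcase.
have sYP : Y \subset P.
  apply/subsetP => y yY; have: y \notin E1.
    apply: contra pNE1 => yE1; apply: (E1step y) => //; apply/RP; by exists Y.
  move: yY (sub_in y sY) (sub_in y sQ); rewrite in_symd; memcase.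
have: #|P| <= #|symd P Y|.
  apply: minP; rewrite /isP symd_sub ?(subset_trans sYP) //=.
  apply/is_joinP => w; rewrite odd_deg_symd jP'.
  by have /even_esetP-> := circle_even cY; rewrite addbF.
have -> : symd P Y = P :\: Y.
  apply/setP => x; move: (sub_in x sYP); rewrite in_symd inE; memcase.
rewrite cardsD (setIidPr sYP) leqNgt ltn_subrL !card_gt0 (circle_neq0 cY) /=.
by have -> : P != set0 by apply/set0Pn; exists p.
Qed.

(** * Ears *)

(* [X :\: H] is a circuit of the contraction by [H], but not a circle itself. *)
Lemma ear_exists (H X0 : {set E}) g :
  is_circle X0 -> g \in X0 -> X0 :&: H != set0 -> g \notin H ->
  exists X, [/\ is_circle X, g \in X, X :&: H != set0 &
    forall Z, even_eset Z -> Z :\: H \subset X :\: H ->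
      Z :\: H = set0 \/ Z :\: H = X :\: H].
Proof.
move=> cX0 gX0 X0H gH.
pose Q (X : {set E}) := [&& is_circle X, g \in X & X :&: H != set0].
have QX0 : Q X0 by rewrite /Q cX0 gX0.
case: (arg_minnP (fun X : {set E} => #|X :\: H|) QX0) => X /and3P[cX gX XH] minX.
exists X; split=> //.
(* A circle through [g] inside [Z] must meet [H]: otherwise it would be contained in [X], hence
   equal to [X], which meets [H]. It then competes with [X] for the minimum. *)
have ming Z : even_eset Z -> Z :\: H \subset X :\: H -> g \in Z -> Z :\: H = X :\: H.
  move=> eZ sZ gZ; have [Y [cY sY gY]] := even_circle eZ gZ.
  have sYX : Y :\: H \subset X :\: H by apply: subset_trans sZ; apply: setSD.
  have YH : Y :&: H != set0.
    apply: contraNneq XH => YH; rewrite -(circle_min cX (circle_even cY)) ?YH //.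
      apply/subsetP => y; move: (sub_in y sYX) (in_set0 y); rewrite -YH !inE; memcase.
    exact: circle_neq0 cY.
  have: Q Y by rewrite /Q cY gY.
  move/minX => leXY; apply/eqP; rewrite eqEcard sZ /=.
  by apply: leq_trans leXY (subset_leq_card _); apply: setSD.
move=> Z eZ sZ; have [gZ|gZ] := boolP (g \in Z); first by right; apply: ming.
(* When [Z] misses [g], the sum [symd Z X] contains it; its trace is then full, so that of [Z] is
   empty. *)
left; have eqH : symd Z X :\: H = X :\: H; last first.
  by apply/setP => y; move/setP/(_ y): eqH (sub_in y sZ); rewrite !inE; memcase.
apply: ming (even_symd eZ (circle_even cX)) _ _.
- apply/subsetP => y; move: (sub_in y sZ); rewrite !inE; memcase.
- by rewrite in_symd gX (negbTE gZ).
Qed.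

Variables (sigma : E -> bool) (e : E) (C : {set E}).
Local Notation positive := (positive sigma).
Hypothesis batC : battery_circle ends1 ends2 sigma e C.

Lemma positive_symd X Y : positive (symd X Y) = ~~ (positive X (+) positive Y).
Proof.
have negE S : #|[set f in S | ~~ sigma f]| = \sum_(f in S) ~~ sigma f.
  rewrite -sum1_card big_mkcond [RHS]big_mkcond; apply: eq_bigr => f _.
  by rewrite inE; case: (f \in S); case: (sigma f).
rewrite /Defs.positive !negE odd_sum_symd.
by do 2!case: (odd _).
Qed.

Lemma battery_is_circle : is_circle C.
Proof. by case: batC => /andP[]. Qed.

Lemma battery_positive : positive C.
Proof. by case: batC => /andP[]. Qed.

Lemma battery_mem : e \in C.
Proof. by case: batC. Qed.

Lemma battery_unique X : is_circle X -> positive X -> e \in X -> X = C.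
Proof. by move=> cX pX; case: batC => _ _; apply; rewrite /Defs.pos_circle cX. Qed.

Local Notation cC := battery_is_circle.

Lemma even_sub_circle Z : even_eset Z -> Z \subset C -> Z = set0 \/ Z = C.
Proof.
move=> eZ sZ; have [->|Z0] := eqVneq Z set0; first by left.
by right; apply: circle_min cC eZ sZ Z0.
Qed.

(** Two even sets with the same trace outside [C] differ by an even subset of [C], which is empty or
    [C]. *)
Lemma even_eqD X Z : even_eset X -> even_eset Z -> Z :\: C = X :\: C ->
  Z = X \/ Z = symd X C.
Proof.
move=> eX eZ /setP ZX.
have [|S0|SC] := @even_sub_circle (symd X Z) (even_symd eX eZ).
- by apply/subsetP => x; move: (ZX x); rewrite !inE; memcase.
- by left; apply/setP => x; move/setP/(_ x): S0; rewrite !inE; memcase.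
- by right; apply/setP => x; move/setP/(_ x): SC; rewrite !inE; memcase.
Qed.

Definition ear X :=
  [/\ even_eset X, X :&: C != set0, ~~ (C \subset X), X :\: C != set0 &
    forall Z, even_eset Z -> Z :\: C \subset X :\: C ->
      Z :\: C = set0 \/ Z :\: C = X :\: C].

Lemma symdCD X : symd X C :\: C = X :\: C.
Proof. by apply/setP => x; rewrite !inE; memcase. Qed.

(** Adding [C] exchanges the two conditions on the trace on [C] and keeps the trace outside. *)
Lemma ear_symdC X : ear X -> ear (symd X C).
Proof.
move=> [eX XC0 CX XC minX]; split; rewrite ?symdCD //.
- exact: even_symd eX (circle_even cC).
- have [x xC xX] := subsetPn CX; apply/set0Pn; exists x.
  by rewrite !inE xC (negbTE xX).
- have [x] := set0Pn _ XC0; rewrite inE => /andP[xX xC]; apply/subsetPn; exists x => //.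
  by rewrite in_symd xX xC.
Qed.

(** Since [C] is positive and contains [e], adding it keeps the sign and toggles [e]. *)
Lemma ear_with X b : ear X ->
  exists X', [/\ ear X', X' :\: C = X :\: C, positive X' = positive X & (e \in X') = b].
Proof.
move=> earX; have [eXb|eXb] := eqVneq (e \in X) b; first by exists X.
exists (symd X C); split; rewrite ?symdCD //; first exact: ear_symdC.
  by rewrite positive_symd battery_positive addbT negbK.
by rewrite in_symd battery_mem addbT; move: eXb; case: b; case: (e \in X).
Qed.

(** Choose the ear through [e]. By minimality of its trace, a circle through [e] inside it is the
    whole ear; were it positive, it would be [C], yet it has edges outside [C]. *)
Lemma ear_negative X : ear X -> ~~ positive X.
Proof.
move=> /(ear_with true)[X' [[eX XC0 CX XC minX] _ <- eX']].
have [Y [cY sY eY]] := even_circle eX eX'.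
have YX : Y = X'.
  have [||YC0|YC] := minX Y; [exact: circle_even | exact: setSD | | ].
    have sYC : Y \subset C by rewrite -setD_eq0 YC0.
    by case/negP: CX; rewrite -(circle_min cC (circle_even cY) sYC (circle_neq0 cY)).
  case: (even_eqD eX (circle_even cY) YC) => // YX; move: eY.
  by rewrite YX in_symd eX' battery_mem.
apply/negP => pX; move: XC.
by rewrite -YX (battery_unique cY) ?YX // setDv eqxx.
Qed.

(* Exactly one of the two even sets with trace [(X1 :|: X2) :\: C] outside [C]
   avoids [e]; it is a circle. *)
Lemma ear_pair X1 X2 : ear X1 -> ear X2 -> (X1 :\: C) :&: (X2 :\: C) = set0 ->
  (forall Z, even_eset Z -> Z :\: C \subset (X1 :\: C) :|: (X2 :\: C) ->
     [\/ Z :\: C = set0, Z :\: C = X1 :\: C, Z :\: C = X2 :\: C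
       | Z :\: C = (X1 :\: C) :|: (X2 :\: C)]) ->
  exists X, [/\ is_circle X, positive X & X :\: C = (X1 :\: C) :|: (X2 :\: C)].
Proof.
move=> /(ear_with true)[Y1 [ear1 <- _ e1]] /(ear_with false)[Y2 [ear2 <- _ e2]] dis span.
have [n1 n2] := (ear_negative ear1, ear_negative ear2).
case: ear1 ear2 => [E1 A1 C1 Q1 _] [E2 A2 C2 Q2 _].
have disP x : ~~ [&& x \in Y1, x \in Y2 & x \notin C].
  by move/setP/(_ x): dis; rewrite !inE; memcase.
have eC := battery_mem; have EC := circle_even cC; have EX := even_symd E1 E2.
have XD : symd Y1 Y2 :\: C = (Y1 :\: C) :|: (Y2 :\: C).
  by apply/setP => x; move: (disP x); rewrite !inE; memcase.
have pX : positive (symd Y1 Y2) by rewrite positive_symd (negbTE n1) (negbTE n2).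
set X := symd Y1 Y2 in XD EX pX.
have eX : e \in X by rewrite in_symd e1 e2.
have X'D : symd X C :\: C = (Y1 :\: C) :|: (Y2 :\: C) by rewrite symdCD.
exists (symd X C); split=> //; last by rewrite positive_symd pX battery_positive.
have EX' := even_symd EX EC.
have subD Z : Z \subset X \/ Z \subset symd X C -> Z :\: C \subset (Y1 :\: C) :|: (Y2 :\: C).
  by case=> sZ; [rewrite -XD | rewrite -X'D]; apply: setSD.
(* A circle [Y'] inside [symd X C] through an edge [q] of [Y1] outside [C] can only have the trace
   of [Y1] or the full trace. *)
have [q] := set0Pn _ Q1; rewrite inE => /andP[qC q1].
have q2 : q \notin Y2 by apply: contra (disP q) => ->; rewrite q1.
have [|Y' [cY' sY' qY']] := @even_circle (symd X C) q EX'.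
  by rewrite !in_symd q1 (negbTE q2) (negbTE qC).
have eY' : e \notin Y' by apply: contraTN eX => /(subsetP sY'); rewrite in_symd eC; case: (e \in X).
suff -> : symd X C = Y' by [].
have [|Y'D|Y'D|Y'D|Y'D] := span Y' (circle_even cY'); first by apply: subD; right.
- by move/setP/(_ q): Y'D; rewrite !inE qC qY'.
(* Here [Y'] is [symd Y1 C], which forces [Y2] to lie inside [Y1] on [C]. A circle [Y] through [e]
   inside [X] then contradicts each possible trace; the full one would make [X] a positive circle
   through [e] other than [C]. *)
- case: (even_eqD E1 (circle_even cY') Y'D) => Y'1; first by move: eY'; rewrite Y'1 e1.
  have s21 x : [&& x \in C & x \in Y2] ==> (x \in Y1).
    by move: (sub_in x sY'); rewrite Y'1 !in_symd; memcase.
  have [Y [cY sY eY]] := even_circle EX eX.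
  have [x] := set0Pn _ A2; rewrite inE => /andP[xY2 xC].
  have xY1 : x \in Y1 by have := s21 x; rewrite xC xY2.
  have sYx := sub_in x sY.
  have [|YD|YD|YD|YD] := span Y (circle_even cY); first by apply: subD; left.
  + case: (@even_sub_circle Y (circle_even cY)) => [|Y0|YC].
    * by rewrite -setD_eq0 YD.
    * by move: eY; rewrite Y0 inE.
    * by move: sYx; rewrite YC in_symd xC xY1 xY2.
  + case: (even_eqD E1 (circle_even cY) YD) => Y1E; last first.
      by move: eY; rewrite Y1E in_symd e1 eC.
    by move: sYx; rewrite Y1E in_symd xY1 xY2.
  + case: (even_eqD E2 (circle_even cY) YD) => Y2E; first by move: eY; rewrite Y2E e2.
    have [y yC yY1] := subsetPn C1.
    move: (s21 y) (sub_in y sY); rewrite Y2E !in_symd yC (negbTE yY1).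
    by case: (y \in Y2).
  + rewrite -XD in YD; case: (even_eqD EX (circle_even cY) YD) => YX; last first.
      by move: eY; rewrite YX in_symd eX eC.
    have YC : Y = C by apply: battery_unique; rewrite // YX.
    have D0 : X :\: C = set0 by rewrite -YX YC setDv.
    by case/negP: Q1; rewrite -subset0 -D0 XD subsetUl.
- by move/setP/(_ q): Y'D; rewrite !inE qC qY' (negbTE q2).
- rewrite -XD in Y'D; case: (even_eqD EX (circle_even cY') Y'D) => [Y'X|//].
  by move: eY'; rewrite Y'X eX.
Qed.

(* [D] is a union of components of the contraction of the cycle space by [C]. *)
Definition separates D := forall Z, even_eset Z ->
  exists2 Z', even_eset Z' & Z' :\: C = Z :&: D.

Lemma ear_circle X : is_circle X -> X :&: C != set0 -> X :\: C != set0 ->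
  (forall Z, even_eset Z -> Z :\: C \subset X :\: C ->
      Z :\: C = set0 \/ Z :\: C = X :\: C) -> ear X.
Proof.
move=> cX XC0 XC minX; split=> //; first exact: circle_even.
apply: contraNN XC => CX; rewrite -(circle_min cX (circle_even cC) CX) ?setDv //.
exact: circle_neq0 cC.
Qed.

(** A component [K] of the trace has its odd vertices on [C], so edges of [C] complete it to an even
    set and minimality makes it the whole trace. A circle inside the trace would be [X], which meets
    [C]. *)
Lemma ear_is_path X : is_circle X -> ear X -> is_path (X :\: C).
Proof.
move=> cX [eX XC0 CX XC minX]; apply/and4P; split=> //.
- apply/forall_inP => a aX; apply/forall_inP => b bX.
  pose K := [set h in X :\: C | connect (eadj (X :\: C)) a h].
  have sK : K \subset X :\: C by apply/subsetP => h; rewrite inE => /andP[].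
  suff /setP/(_ b) : K = X :\: C by rewrite bX inE bX.
  have oddC v : odd (deg K v) -> v \in vset C.
    move=> oK; case: (@deg_part (X :\: C) K v sK) => [f g||d0].
    + rewrite inE => /andP[fX fa] gX fv gv; rewrite inE gX.
      apply: connect_trans fa (connect1 _).
      by apply/and3P; split=> //; apply/existsP; exists v; rewrite fv.
    + move=> dK; rewrite dK in oK; have: 0 < deg (X :&: C) v.
        move/even_esetP/(_ v): eX; rewrite (@deg_split X (X :\: C)) ?subsetDl //.
        by rewrite oddD oK setDDr setDv set0U addTb => /negbFE/odd_gt0.
      by rewrite deg_gt0 => /vsetP[f /setIP[_ fC] fv]; apply: vset_inc fv.
    + by rewrite d0 in oK.
  have [A sA eA] := complete_even (circle_connected cC) oddC.
  have KA : symd K A :\: C = K.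
    by apply/setP => x; move: (sub_in x sA) (sub_in x sK); rewrite !in_setD in_symd; memcase.
  have := minX _ eA; rewrite KA => /(_ sK)[K0|//].
  by move/setP/(_ a): K0; rewrite !(aX, inE) connect0.
- apply/forallP => v; apply: leq_trans (circle_deg v cX).
  by rewrite (@deg_split X (X :\: C)) ?subsetDl // leq_addr.
- apply/forall_inP => Q sQ; apply/negP => cQ.
  have QX : Q = X.
    have sQX := subset_trans sQ (subsetDl X C).
    exact: (circle_min cX (circle_even cQ) sQX (circle_neq0 cQ)).
  case/set0Pn: XC0 => x; rewrite inE => /andP[+ xC]; rewrite -QX => /(subsetP sQ).
  by rewrite inE xC.
Qed.

(** * Bridges *)

Local Notation is_bridge := (is_bridge ends1 ends2 C).
Local Notation comp_bridge := (comp_bridge ends1 ends2 C).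
Local Notation outadj := (outadj ends1 ends2 C).

Lemma outadj_sym : symmetric outadj.
Proof.
move=> u v; rewrite /Defs.outadj /= andbCA; congr [&& _, _ & _].
by apply/existsP/existsP => -[f ef]; exists f; rewrite orbC.
Qed.

Lemma inc_outadj f u v : inc f u -> inc f v -> u \notin vset C -> v \notin vset C ->
  u != v -> outadj u v.
Proof.
move=> fu fv uC vC uv; apply/and3P; split=> //; apply/existsP; exists f.
by move: fu fv uv => /orP[]/eqP<- /orP[]/eqP<-; rewrite ?eqxx ?orbT.
Qed.

Lemma inc_connect f u v : inc f u -> inc f v -> u \notin vset C -> v \notin vset C ->
  connect outadj u v.
Proof.
move=> fu fv uC vC; have [->|uv] := eqVneq u v; first exact: connect0.
exact/connect1/(inc_outadj fu fv).
Qed.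

Lemma comp_bridgeP x f : reflect
  (exists u, [/\ inc f u, u \notin vset C & connect outadj x u]) (f \in comp_bridge x).
Proof. by rewrite inE; apply: (iffP existsP) => -[u /and3P fu]; exists u. Qed.

Lemma comp_bridge_inc x f u : inc f u -> u \notin vset C ->
  (f \in comp_bridge x) = connect outadj x u.
Proof.
move=> fu uC; apply/comp_bridgeP/idP => [[v [fv vC xv]]|xu]; last by exists u.
exact/(connect_trans xv)/(inc_connect fv).
Qed.

Lemma bridge_notin D f : is_bridge D -> f \in D -> f \notin C.
Proof.
case=> [[g /and4P[gC _ _ _] ->]|[x xC ->]]; first by rewrite inE => /eqP->.
move=> /comp_bridgeP[u [fu uC _]]; apply: contra uC => fC; exact: vset_inc fu.
Qed.

Lemma bridge_closed D f g u : is_bridge D -> f \in D -> inc f u -> inc g u ->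
  u \notin vset C -> g \in D.
Proof.
case=> [[h /and4P[_ _ h1 h2] ->]|[x xC ->]].
  by rewrite inE => /eqP-> /orP[]/eqP<-; rewrite ?h1 ?h2.
by move=> fD fu gu uC; rewrite (comp_bridge_inc _ gu) // -(comp_bridge_inc _ fu).
Qed.

(** By [bridge_closed], the part of [Z] in [D] can be odd only at vertices of [C], where edges of
    [C] repair it. *)
Lemma bridge_separates D : is_bridge D -> separates D.
Proof.
move=> bD Z eZ; have oddC v : odd (deg (Z :&: D) v) -> v \in vset C.
  apply: contraTT => vC.
  case: (@deg_part Z (Z :&: D) v (subsetIl _ _)) => [f g||->//].
    move=> /setIP[_ fD] gZ fv gv; rewrite inE gZ /=; exact: bridge_closed fD fv gv vC.
  by move=> ->; rewrite (even_esetP _ eZ).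
have [A sA eA] := complete_even (circle_connected cC) oddC.
exists (symd (Z :&: D) A) => //; apply/setP => x; move: (sub_in x sA).
have: (x \in D) ==> (x \notin C) by apply/implyP/bridge_notin.
by rewrite in_setD in_symd in_setI; memcase.
Qed.

(** A chord has both ends on [C], while an edge of a component bridge has an end off [C] that
    determines the component. *)
Lemma bridge_eq D D' f : is_bridge D -> is_bridge D' -> f \in D -> f \in D' -> D = D'.
Proof.
have chord_comp g x : chord ends1 ends2 C g -> g \notin comp_bridge x.
  move=> /and4P[_ _ g1 g2]; apply/comp_bridgeP => -[u [/orP[]/eqP<-]].
    by rewrite g1.
  by rewrite g2.
case=> [[g cg ->]|[x xC ->]] [[g' cg' ->]|[x' xC' ->]].
- by rewrite !inE => /eqP-> /eqP->.
- by rewrite inE => /eqP->; rewrite (negbTE (chord_comp _ _ cg)).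
- by move=> fx; rewrite inE => /eqP fg; rewrite fg (negbTE (chord_comp _ _ cg')) in fx.
move=> /comp_bridgeP[u [fu uC xu]]; rewrite (comp_bridge_inc _ fu) // => xu'.
have same : connect outadj x =1 connect outadj x'.
  apply: same_connect; first exact: sym_connect_sym outadj_sym.
  by apply: connect_trans xu _; rewrite (sym_connect_sym outadj_sym).
by apply/setP => g; apply/comp_bridgeP/comp_bridgeP => -[w wP]; exists w; move: wP; rewrite same.
Qed.

Lemma bridge_cover f : f \notin C -> exists2 D, is_bridge D & f \in D.
Proof.
move=> fC; have out v : inc f v -> v \notin vset C -> exists2 D, is_bridge D & f \in D.
  move=> fv vC; exists (comp_bridge v); first by right; exists v.
  by rewrite (comp_bridge_inc _ fv).
have [f1|/out] := boolP (ends1 f \in vset C); last by apply; apply: inc1.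
have [f2|/out] := boolP (ends2 f \in vset C); last by apply; apply: inc2.
exists [set f]; last by rewrite inE.
left; exists f => //; apply/and4P; split=> //.
apply: (block_no_loop (g := e)); apply: contraNneq fC => ->.
exact: battery_mem.
Qed.

(** As an edge set, the bridge of an isolated vertex would be empty; connectedness of the graph
    excludes this. *)
Lemma bridge_neq0 D : is_bridge D -> exists f, f \in D.
Proof.
case=> [[f _ ->]|[x xC ->]]; first by exists f; rewrite inE.
suff [//|[f fx]] : ends1 e = x \/ exists f, inc f x.
- move=> ex; case/negP: xC; rewrite -ex; apply: vset_inc (inc1 _).
  exact: battery_mem.
- by exists f; rewrite (comp_bridge_inc _ fx) ?connect0.
case: block => conn _; have := conn (ends1 e) x.
apply: (connect_inv (P := fun v => ends1 e = v \/ exists f, inc f v)); last by left.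
move=> a b /existsP[f /orP[]/andP[/eqP<- /eqP<-]] _; right; exists f.
  exact: inc2.
exact: inc1.
Qed.

(** Both ends of every edge are kept off [C], so that the join has no edge at a vertex of [C]. *)
Lemma comp_bridge_joined x u v : u \notin vset C -> connect outadj u v -> connect outadj x u ->
  joined [set g in comp_bridge x | (ends1 g \notin vset C) && (ends2 g \notin vset C)] u v.
Proof.
move=> uC uv xu; set O := [set g in _ | _].
suff H w : connect outadj u w -> connect outadj x w /\ joined O u w by case: (H v uv).
apply: (connect_inv (P := fun w => connect outadj x w /\ joined O u w)).
  move=> a b ab [xa ja]; have xb := connect_trans xa (connect1 ab); split=> //.
  case/and3P: ab => aC bC /existsP[f ef].
  have [fa fb] : inc f a /\ inc f b.
    by case/orP: ef => /andP[/eqP<- /eqP<-]; split; rewrite ?inc1 ?inc2.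
  apply: joined_trans ja (joined_edge _ fa fb).
  rewrite inE (comp_bridge_inc _ fa) // xa /=.
  by case/orP: ef => /andP[/eqP-> /eqP->]; rewrite aC bC.
by rewrite joined_refl.
Qed.

(* An inner vertex of the path on [C] would split it into two parts, linked
   once more through the component: the bridge would contain a circle. *)
Lemma bridge_path_min D Z : is_bridge D -> is_path D -> even_eset Z ->
  Z :&: D = set0 \/ D \subset Z.
Proof.
move=> bD /and4P[_ connD /forallP degD /forall_inP noC] eZ.
have [|[a]] := set_0Vmem (Z :&: D); [by left | move=> /setIP[aZ aD]; right].
apply/subsetP => b bD'.
have /forall_inP/(_ a aD)/forall_inP/(_ b bD') := connD.
apply: (connect_inv (P := fun b => b \in Z)) aZ => {a b aD bD'} c d.
move=> /and3P[cD dD /existsP[w /andP[cw dw]]] cZ; apply/negPn/negP => dZ.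
have cd : c != d by apply: contraNneq dZ => <-.
(* Off [C], all edges of [Z] at [w] lie in [D]: at least two by parity, and with [d] they exceed the
   degree bound of a path. *)
have [wC|wC] := boolP (w \in vset C); last first.
  have dZE : deg (Z :&: D) w = deg Z w.
    case: (@deg_part Z (Z :&: D) w (subsetIl _ _)) => [f g||] //.
      move=> /setIP[_ fD] gZ fw gw; rewrite inE gZ /=; exact: bridge_closed fD fw gw wC.
    move/eqP; rewrite eqn0Ngt deg_gt0; case/negP; apply: vset_inc cw; by rewrite inE cZ.
  have := degD w; rewrite (@deg_split D (Z :&: D)) ?subsetIr // dZE.
  have : 0 < deg (D :\: (Z :&: D)) w.
    by rewrite deg_gt0; apply: vset_inc dw; rewrite !inE (negbTE dZ).
  have : 0 < deg Z w by rewrite deg_gt0; apply: vset_inc cw.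
  have /even_esetP/(_ w) := eZ.
  by case: (deg Z w) => [|[|[|?]]] //; case: (deg _ w).
case: (bD) => [[g _ DE]|[x xC DE]].
  by move: cD dD; rewrite DE !inE => /eqP cg /eqP dg; rewrite cg dg eqxx in cd.
have outend f : f \in D -> exists2 u, inc f u & u \notin vset C /\ connect outadj x u.
  by rewrite DE => /comp_bridgeP[u [fu uC xu]]; exists u.
have [u cu [uC xu]] := outend c cD; have [v dv [vC xv]] := outend d dD.
have uv : connect outadj u v.
  by apply: connect_trans xv; rewrite (sym_connect_sym outadj_sym).
have /joinedP[P sP /is_joinP jP] := comp_bridge_joined uC uv xu.
have PN h : inc h w -> h \notin P.
  move=> hw; apply/negP => /(subsetP sP); rewrite inE => /and3P[_ h1 h2].
  by case/orP: hw => /eqP hw; move: wC; rewrite -hw ?(negbTE h1) ?(negbTE h2).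
have wu : w != u by apply: contraTneq wC => ->.
have wv : w != v by apply: contraTneq wC => ->.
(* The edges [c] and [d] close up the join [P] at [w], giving a nonempty even set inside the
   path. *)
pose X := symd P (symd [set c] [set d]).
have eX : even_eset X.
  apply/even_esetP => y; rewrite !odd_deg_symd jP (deg_edge _ cw cu wu) (deg_edge _ dw dv wv).
  by rewrite !oddD !oddb; do 3!case: (y == _).
have cX : c \in X by rewrite !in_symd !inE eqxx (negbTE cd) (negbTE (PN c cw)).
have [Y [cY sY _]] := even_circle eX cX.
have sXD : X \subset D.
  rewrite !symd_sub ?sub1set //; apply: subset_trans sP _.
  by apply/subsetP => h; rewrite DE inE => /andP[].
by have := noC Y (subset_trans sY sXD); rewrite cY.
Qed.

(** Start from a circle through [f] and [e] and minimize its trace outside [C]. The part of this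
    trace in [D] contains [f] and comes from an even set, so it is the whole trace. *)
Lemma bridge_ear D f : is_bridge D -> f \in D ->
  exists X, [/\ ear X, is_circle X, f \in X & X :\: C \subset D].
Proof.
move=> bD fD; have fC := bridge_notin bD fD; have eC := battery_mem.
have fe : f != e by apply: contraNneq fC => ->.
have [X0 [cX0 fX0 eX0]] := block_common_circle fe.
have [|X [cX fX XC minX]] := ear_exists cX0 fX0 _ fC.
  by apply/set0Pn; exists e; rewrite inE eX0.
exists X.
have [Z eZ ZE] := bridge_separates bD (circle_even cX).
have DC x : (x \in D) ==> (x \notin C) by apply/implyP/bridge_notin.
have [|Z0|ZX] := minX Z eZ.
- by apply/subsetP => x; move: (DC x); rewrite ZE !inE; memcase.
- by move/setP/(_ f): Z0; rewrite ZE !inE fX fD.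
split=> //; last by rewrite -ZX ZE subsetIr.
apply: (ear_circle) => //.
by apply/set0Pn; exists f; rewrite inE fC.
Qed.

(** Distinct bridges are disjoint, and cutting an even set along each of them lets the minimality of
    the two ears act separately; this gives the four traces required by [ear_pair]. *)
Lemma bridges_pair D1 D2 X1 X2 : is_bridge D1 -> is_bridge D2 -> D1 != D2 ->
  ear X1 -> X1 :\: C \subset D1 -> ear X2 -> X2 :\: C \subset D2 ->
  exists X, [/\ is_circle X, positive X & X :\: C = (X1 :\: C) :|: (X2 :\: C)].
Proof.
move=> b1 b2 D12 ear1 s1 ear2 s2.
have dis x : ~~ ((x \in D1) && (x \in D2)).
  by apply: contra D12 => /andP[x1 x2]; apply/eqP; apply: bridge_eq b1 b2 x1 x2.
have DC1 x : (x \in D1) ==> (x \notin C) by apply/implyP/bridge_notin.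
have DC2 x : (x \in D2) ==> (x \notin C) by apply/implyP/bridge_notin.
apply: (ear_pair) => //.
  by apply/setP => x; move: (sub_in x s1) (sub_in x s2) (dis x); rewrite !inE; memcase.
move=> Z eZ sZ; have [Z1 eZ1 E1] := bridge_separates b1 eZ.
have [Z2 eZ2 E2] := bridge_separates b2 eZ.
have ZE : Z :\: C = (Z1 :\: C) :|: (Z2 :\: C).
  rewrite E1 E2; apply/setP => x.
  move: (sub_in x s1) (sub_in x s2) (DC1 x) (DC2 x) (sub_in x sZ).
  by rewrite !inE; memcase.
have m1 : Z1 :\: C = set0 \/ Z1 :\: C = X1 :\: C.
  case: ear1 => _ _ _ _; apply=> //; rewrite E1; apply/subsetP => x.
  move: (sub_in x s1) (sub_in x s2) (DC1 x) (dis x) (sub_in x sZ).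
  by rewrite !inE; memcase.
have m2 : Z2 :\: C = set0 \/ Z2 :\: C = X2 :\: C.
  case: ear2 => _ _ _ _; apply=> //; rewrite E2; apply/subsetP => x.
  move: (sub_in x s1) (sub_in x s2) (DC2 x) (dis x) (sub_in x sZ).
  by rewrite !inE; memcase.
rewrite ZE; case: m1 m2 => -> [] ->; rewrite ?set0U ?setU0.
- by constructor 1.
- by constructor 3.
- by constructor 2.
- by constructor 4.
Qed.

(** * Batteries on the bridges *)

Local Notation pos_battery := (pos_battery ends1 ends2 sigma).

Lemma two_circles_not_battery X Y f : is_circle X -> positive X -> f \in X ->
  is_circle Y -> positive Y -> f \in Y -> X != Y -> ~~ pos_battery f.
Proof.
move=> cX pX fX cY pY fY; apply: contra => /cards1P[Z ZE].
have mem W : is_circle W -> positive W -> f \in W -> W = Z.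
  by move=> cW pW fW; apply/set1P; rewrite -ZE inE fW andbT; apply/andP.
by rewrite (mem X) // (mem Y).
Qed.

Section TwoBridges.
Variables D1 D2 : {set E}.
Hypotheses (b1 : is_bridge D1) (b2 : is_bridge D2) (D12 : D1 != D2).

Let D1C x : (x \in D1) ==> (x \notin C).
Proof. exact/implyP/(bridge_notin b1). Qed.

Let D2C x : (x \in D2) ==> (x \notin C).
Proof. exact/implyP/(bridge_notin b2). Qed.

Let dis x : ~~ ((x \in D1) && (x \in D2)).
Proof. by apply: contra D12 => /andP[x1 x2]; apply/eqP; apply: bridge_eq b1 b2 x1 x2. Qed.

(** A positive circle [T] through [f] contains [D1], and contains or avoids [D2]. Avoiding [D2]
    makes it an ear, hence negative; otherwise it is [X] or [symd X C], and only one of these avoids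
    [e]. *)
Lemma two_paths_battery f : (forall g, g \notin C -> g \in D1 \/ g \in D2) ->
  is_path D1 -> is_path D2 -> f \in D1 -> pos_battery f.
Proof.
move=> cov p1 p2 f1; have fC := implyP (D1C f) f1.
have eC := battery_mem; have EC := circle_even cC.
have covb x : [|| x \in C, x \in D1 | x \in D2].
  by have [//|/cov[]->] := boolP (x \in C); rewrite ?orbT.
have [h h2] := bridge_neq0 b2.
have [X1 [ear1 c1 fX1 s1]] := bridge_ear b1 f1.
have [X2 [ear2 c2 hX2 s2]] := bridge_ear b2 h2.
have [X [cX pX XE]] := bridges_pair b1 b2 D12 ear1 s1 ear2 s2.
have full D Z g : is_bridge D -> is_path D -> even_eset Z -> g \in Z -> g \in D -> D \subset Z.
  move=> bD pD eZ gZ gD; case: (bridge_path_min bD pD eZ) => // /setP/(_ g).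
  by rewrite !inE gZ gD.
have t1 := full _ _ _ b1 p1 (circle_even c1) fX1 f1.
have t2 := full _ _ _ b2 p2 (circle_even c2) hX2 h2.
have fX : f \in X by have /setP/(_ f) := XE; rewrite !inE fC fX1.
have not_e Z : is_circle Z -> positive Z -> f \in Z -> e \notin Z.
  move=> cZ pZ fZ; apply: contra fC => eZ; by rewrite -(battery_unique cZ pZ eZ).
apply/cards1P; exists X; apply/setP => T; rewrite !inE.
apply/andP/eqP => [[/andP[cT pT] fT]|->]; last by split=> //; apply/andP.
have tT := full _ _ _ b1 p1 (circle_even cT) fT f1.
case: (bridge_path_min b2 p2 (circle_even cT)) => [T0|tT2].
- have TE : T :\: C = X1 :\: C.
    apply/setP => x; move/setP/(_ x): T0; move: (sub_in x s1) (sub_in x t1) (sub_in x tT) (covb x).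
    by rewrite !inE; memcase.
  case: (even_eqD (circle_even c1) (circle_even cT) TE) => TX.
    by case/negP: (ear_negative ear1); rewrite -TX.
  by case/negP: (ear_negative (ear_symdC ear1)); rewrite -TX.
have TE : T :\: C = X :\: C.
  apply/setP => x; move: (sub_in x s1) (sub_in x s2) (sub_in x t1) (sub_in x t2).
  by move: (sub_in x tT) (sub_in x tT2) (covb x); rewrite XE !inE; memcase.
case: (even_eqD (circle_even cX) (circle_even cT) TE) => // TX.
by have := not_e T cT pT fT; rewrite TX in_symd (negbTE (not_e X cX pX fX)) eC.
Qed.

(* If [X1] is the ear of [f], take an ear [Q] of [C :|: X1] through [g], and
   [Y] even through [f] with trace [Q]; the even sets inside [C :|: X1 :|: Q]
   are generated by [C], [X1] and [Y]. *)
Lemma second_positive_circle X1 X2 f g : ear X1 -> X1 :\: C \subset D1 -> f \in X1 ->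
  f \notin C -> ear X2 -> X2 :\: C \subset D2 -> g \in D1 -> g \notin X1 ->
  exists T, [/\ is_circle T, positive T, f \in T & g \in T].
Proof.
move=> ear1 s1 fX1 fC ear2 s2 g1 gX1; have gC := implyP (D1C g) g1.
have eC := battery_mem; have EC := circle_even cC.
case: (ear1) => E1 A1 C1 Q1 min1.
have ge : g != e by apply: contraNneq gC => ->.
have [X0 [cX0 gX0 eX0]] := block_common_circle ge.
have [||W [cW gW WH minW]] := @ear_exists (C :|: X1) X0 g cX0 gX0.
- by apply/set0Pn; exists e; rewrite !inE eX0 eC.
- by rewrite inE negb_or gC.
set H := C :|: X1 in WH minW.
have gH : g \notin H by rewrite inE negb_or gC.
have EW := circle_even cW.
set Q := W :\: H in minW.
have QE x : (x \in Q) = [&& x \in W, x \notin C & x \notin X1].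
  by rewrite in_setD in_setU; memcase.
have HE x : (x \in H) = (x \in C) || (x \in X1) by rewrite inE.
have sQW : Q \subset W by apply: subsetDl.
have WQ : W :\: H = Q by [].
clearbody Q H.
have gQ : g \in Q by rewrite QE gW gC gX1.
have fQ : f \notin Q by rewrite QE fX1 andbF andbF.
have QD1 : Q \subset D1.
  have [Z eZ ZE] := bridge_separates b1 EW.
  have ZP x : (x \in Z) && (x \notin C) = (x \in W) && (x \in D1).
    by move/setP/(_ x): ZE; rewrite !inE andbC.
  have [|Z0|ZQ] := minW Z eZ.
  - apply/subsetP => x; move: (ZP x); rewrite QE in_setD HE; memcase.
  - move/setP/(_ g): Z0; move: (ZP g); rewrite in_setD HE in_set0.
    by rewrite gW g1 (negbTE gC) (negbTE gX1); memcase.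
  apply/subsetP => x; move/setP/(_ x): ZQ; move: (ZP x); rewrite QE in_setD HE; memcase.
(* An even [Q] would be the circle [W] itself, but [W] meets [H]. *)
have Q_odd : ~~ even_eset Q.
  apply/negP => eQ; have QW : Q = W.
    by apply: (circle_min cW eQ sQW); apply/set0Pn; exists g.
  case/set0Pn: WH => x; rewrite in_setI -{1}QW QE HE; memcase.
have [Y [eY fY YQ]] : exists Y, [/\ even_eset Y, f \in Y & Y :\: H = Q].
  have [fW|fW] := boolP (f \in W); first by exists W.
  exists (symd W X1); split; first exact: even_symd.
    by rewrite in_symd fX1 (negbTE fW).
  by apply/setP => x; rewrite QE in_setD HE in_symd; memcase.
have YP x : [&& x \in Y, x \notin C & x \notin X1] = (x \in Q).
  by rewrite -YQ in_setD HE; memcase.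
have gY : g \in Y by have := YP g; rewrite gQ; case: (g \in Y).
have spanH Z : even_eset Z -> Z \subset H -> Z :\: C = set0 \/ Z :\: C = X1 :\: C.
  move=> eZ sZ; apply: min1 => //; apply/subsetP => x; move: (sub_in x sZ).
  by rewrite HE !in_setD; memcase.
have span Z : even_eset Z -> Z :\: H \subset Q ->
    [\/ Z :\: C = set0, Z :\: C = X1 :\: C, Z :\: C = Y :\: C
      | Z :\: C = symd Y X1 :\: C].
  move=> eZ sZ; have [Z0|ZQ] := minW Z eZ sZ.
    have [|Z1|Z1] := spanH Z eZ; first by rewrite -setD_eq0 Z0.
      by constructor 1.
    by constructor 2.
  have [|Z1|Z1] := spanH (symd Z Y) (even_symd eZ eY).
  - apply/subsetP => x; move/setP/(_ x): ZQ; move: (YP x).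
    by rewrite in_symd in_setD HE; memcase.
  - constructor 3; apply/setP => x; move/setP/(_ x): Z1; rewrite !inE; memcase.
  - constructor 4; apply/setP => x; move/setP/(_ x): Z1; rewrite !inE; memcase.
have subQ Z x : Z :\: C \subset Y :\: C \/ Z :\: C \subset (X1 :\: C) :|: Q ->
  (x \in Z :\: H) ==> (x \in Q).
  by case=> /(sub_in x); rewrite ?in_setU !in_setD HE -YP; memcase.
have subQ' Z : Z :\: C \subset Y :\: C \/ Z :\: C \subset (X1 :\: C) :|: Q ->
  Z :\: H \subset Q.
  by move=> sZ; apply/subsetP => x; apply/implyP/subQ.
(* If the trace of [X1] lies in [Y], then [symd Y X1] has trace [Q]. It is an ear because [Q] is not
   even, and it pairs with [X1] inside the single bridge [D1]. *)
have [sX1Y|] := boolP (X1 :\: C \subset Y).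
  set Y2 := symd Y X1.
  have E2 : even_eset Y2 by apply: even_symd.
  have Y2D : Y2 :\: C = Q.
    apply/setP => x; move: (YP x) (sub_in x sX1Y); rewrite !in_setD in_symd; memcase.
  have Y2ear : ear Y2.
    split=> //.
    - apply: contraNneq Q_odd => Y20; suff <- : Y2 = Q by [].
      rewrite -Y2D; apply/setP => x; move/setP/(_ x): Y20; rewrite in_setI in_setD in_set0; memcase.
    - apply: contraNN Q_odd => CY2; suff <- : symd Y2 C = Q by apply: even_symd.
      rewrite -Y2D; apply/setP => x; move: (sub_in x CY2).
      rewrite [x \in symd _ C]in_symd in_setD; memcase.
    - by rewrite Y2D; apply/set0Pn; exists g.
    rewrite Y2D => Z eZ sZ; have [||/setP ZE|/setP ZE|] := span Z eZ.
    - by apply: subQ'; right; apply: subset_trans sZ (subsetUr _ _).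
    - by left.
    - by move: (ZE f) (sub_in f sZ); rewrite (negbTE fQ) in_setD => ->; rewrite in_setD fX1 fC.
    - by move: (ZE f) (sub_in f sZ); rewrite (negbTE fQ) in_setD => ->; rewrite in_setD fY fC.
    - by rewrite Y2D; right.
  have [||T [cT pT TE]] := ear_pair ear1 Y2ear.
  - rewrite Y2D; apply/setP => x; rewrite in_setI QE in_setD in_set0; memcase.
  - rewrite Y2D => Z eZ sZ; have [|||ZY|] := span Z eZ.
    + by apply: subQ'; right.
    + by constructor 1.
    + by constructor 2.
    + constructor 4; rewrite ZY; apply/setP => x; move: (YP x) (sub_in x sX1Y).
      by rewrite in_setU !in_setD; memcase.
    + by rewrite Y2D; constructor 3.
  exists T; rewrite cT pT; split=> //.
    by move/setP/(_ f): TE; rewrite in_setU !in_setD fX1 fC => /andP[].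
  by move/setP/(_ g): TE; rewrite Y2D in_setU !in_setD gQ orbT => /andP[].
move=> /subsetPn[q]; rewrite in_setD => /andP[qC qX1] qY.
(* The edge [q] of [X1] missed by [Y] rules out two of the four traces, so the trace of [Y] is
   minimal. *)
have minY Z : even_eset Z -> Z :\: C \subset Y :\: C ->
    Z :\: C = set0 \/ Z :\: C = Y :\: C.
  move=> eZ sZ; have [||/setP ZE|ZE|/setP ZE] := span Z eZ; first by apply: subQ'; left.
  - by left.
  - by move: (ZE q) (sub_in q sZ); rewrite !in_setD qX1 qC (negbTE qY) => ->.
  - by right.
  - by move: (ZE q) (sub_in q sZ); rewrite !in_setD in_symd qX1 qC (negbTE qY) => ->.
have YC0 : Y :\: C != set0 by apply/set0Pn; exists f; rewrite in_setD fC.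
have YD1 : Y :\: C \subset D1.
  apply/subsetP => x; move: (YP x) (sub_in x s1) (sub_in x QD1); rewrite !in_setD; memcase.
(* With a nontrivial trace on [C], [Y] is an ear in [D1] and pairs with [X2] from the other bridge.
   Otherwise [Y] or [symd Y C] is a circle [Y0] disjoint from [C]. *)
have [nY|] := boolP ((Y :&: C != set0) && ~~ (C \subset Y)).
  have earY : ear Y by case/andP: nY.
  have [T [cT pT TE]] := bridges_pair b1 b2 D12 earY YD1 ear2 s2.
  exists T; split=> //.
    by move/setP/(_ f): TE; rewrite in_setU !in_setD fY fC => /andP[].
  by move/setP/(_ g): TE; rewrite in_setU !in_setD gY gC => /andP[].
rewrite negb_and !negbK => trivY.
have [Y0 [E0 Y0D Y0C]] : exists Y0, [/\ even_eset Y0, Y0 :\: C = Y :\: C &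
    forall x, (x \in C) ==> (x \notin Y0)].
  case/orP: trivY => [/eqP/setP YC|CY]; [exists Y | exists (symd Y C)]; split=> //.
  - by move=> x; move: (YC x); rewrite in_setI in_set0; memcase.
  - exact: even_symd.
  - exact: symdCD.
  - by move=> x; move: (sub_in x CY); rewrite in_symd; memcase.
have Y0P x : (x \notin C) ==> ((x \in Y0) == (x \in Y)).
  by move/setP/(_ x): Y0D; rewrite !in_setD; memcase.
have fY0 : f \in Y0 by move: (Y0P f); rewrite fC fY => /eqP.
have gY0 : g \in Y0 by move: (Y0P g); rewrite gC gY => /eqP.
have eY0 : e \notin Y0 by move: (Y0C e); rewrite eC.
have cY0 : is_circle Y0.
  have [Z [cZ sZ fZ]] := even_circle E0 fY0.
  have [|Z0|ZY] := minY Z (circle_even cZ); first by rewrite -Y0D setSD.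
    by move/setP/(_ f): Z0; rewrite in_setD fZ fC in_set0.
  rewrite -Y0D in ZY; case: (even_eqD E0 (circle_even cZ) ZY) => [<-//|ZE].
  by move: (sub_in e sZ); rewrite ZE in_symd eC (negbTE eY0).
have [pY0|nY0] := boolP (positive Y0); first by exists Y0.
have [X1' [earX' X1'D pX' eX']] := ear_with true ear1.
have nX' := ear_negative earX'.
case: earX' => E1' A1' C1' _ _.
have X1'P x : (x \notin C) ==> ((x \in X1') == (x \in X1)).
  by move/setP/(_ x): X1'D; rewrite !in_setD; memcase.
(* If [Y0] is negative, [U] is positive, contains [e] and avoids [f]. A circle through [e] inside it
   must be [U], hence [C], although [U] contains [g]. *)
pose U := symd Y0 X1'.
have EU : even_eset U by apply: even_symd.
have eU : e \in U by rewrite in_symd eX' (negbTE eY0).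
have fU : f \notin U by rewrite in_symd fY0; move: (X1'P f); rewrite fC fX1 => /eqP->.
have UD : U :\: C = symd Y X1 :\: C.
  by apply/setP => x; move: (X1'P x) (Y0P x); rewrite !in_setD !in_symd; memcase.
have [T [cT sT eT]] := even_circle EU eU.
have fT : f \notin T by apply: contra fU; apply/subsetP.
have [||/setP TE|/setP TE|TE] := span T (circle_even cT).
- apply: (subset_trans (setSD _ sT)); apply/subsetP => x; move: (YP x) (X1'P x) (Y0P x).
  by rewrite in_setD HE in_symd; memcase.
- move=> T0; have sTC : T \subset C by rewrite -setD_eq0 T0.
  case/negP: C1'; rewrite -{1}(circle_min cC (circle_even cT) sTC (circle_neq0 cT)).
  apply/subsetP => x; move: (sub_in x sT) (sub_in x sTC) (Y0C x); rewrite in_symd; memcase.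
- by move: (TE f); rewrite !in_setD (negbTE fT) fX1 fC.
- by move: (TE f); rewrite !in_setD (negbTE fT) fY fC.
rewrite -UD in TE; case: (even_eqD EU (circle_even cT) TE) => TU; last first.
  by move: eT; rewrite TU in_symd eU eC.
have pT : positive T by rewrite TU positive_symd (negbTE nY0) (negbTE nX').
have := battery_unique cT pT eT => TC.
by move/setP/(_ g): TU; move: (X1'P g); rewrite TC in_symd (negbTE gC) gY0 (negbTE gX1) => /eqP->.
Qed.

(** The circle [X] has trace [X1] and [X2]. An edge [g] of [D2] missed by [X2] gives another ear to
    pair with [X1]; an edge of [D1] missed by [X1] calls for [second_positive_circle]. If neither
    exists, both bridges are traces of ears, hence paths. *)
Lemma nonpath_not_battery f : ~~ (is_path D1 && is_path D2) -> f \in D1 -> ~~ pos_battery f.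
Proof.
move=> np f1; have fC := implyP (D1C f) f1.
have [h h2] := bridge_neq0 b2.
have [X1 [ear1 c1 fX1 s1]] := bridge_ear b1 f1.
have [X2 [ear2 c2 hX2 s2]] := bridge_ear b2 h2.
have [X [cX pX XE]] := bridges_pair b1 b2 D12 ear1 s1 ear2 s2.
have XP x : (x \notin C) ==> ((x \in X) == (x \in X1) || (x \in X2)).
  by move/setP/(_ x): XE; rewrite !inE; memcase.
have fX : f \in X by move: (XP f); rewrite fC fX1 => /eqP.
have [t2|/subsetPn[g g2 gX2]] := boolP (D2 \subset X2); last first.
  have gC := implyP (D2C g) g2.
  have [X2' [ear2' c2' gX2' s2']] := bridge_ear b2 g2.
  have [X' [cX' pX' XE']] := bridges_pair b1 b2 D12 ear1 s1 ear2' s2'.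
  apply: (two_circles_not_battery cX pX fX cX' pX').
    by move/setP/(_ f): XE'; rewrite !inE fX1 fC.
  apply: contraTneq isT => XX'; rewrite -XX' in XE'.
  move: (XP g); move/setP/(_ g): XE'; move: (dis g) (sub_in g s1).
  by rewrite !inE gC g2 gX2' (negbTE gX2); memcase.
have [t1|/subsetPn[g g1 gX1]] := boolP (D1 \subset X1).
  case/negP: np; apply/andP; split.
    suff <- : X1 :\: C = D1 by apply: (ear_is_path).
    by apply/setP => x; move: (sub_in x s1) (sub_in x t1) (D1C x); rewrite in_setD; memcase.
  suff <- : X2 :\: C = D2 by apply: (ear_is_path).
  by apply/setP => x; move: (sub_in x s2) (sub_in x t2) (D2C x); rewrite in_setD; memcase.
have [T [cT pT fT gT]] := second_positive_circle ear1 s1 fX1 fC ear2 s2 g1 gX1.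
apply: (two_circles_not_battery cX pX fX cT pT fT).
apply: contraTneq gT => <-; have gC := implyP (D1C g) g1.
move: (XP g) (sub_in g s2) (dis g); by rewrite !inE gC (negbTE gX1) g1; memcase.
Qed.

End TwoBridges.

End CycleSpace.

Theorem mainTheorem7 (V E : finType) (ends1 ends2 : E -> V) (sigma : E -> bool)
  (e : E) (C D1 D2 : {set E}) :
  is_block ends1 ends2 ->
  #|E| != 1 ->
  ~~ is_circle ends1 ends2 [set: E] ->
  battery_circle ends1 ends2 sigma e C ->
  D1 != D2 ->
  (forall D : {set E}, is_bridge ends1 ends2 C D <-> D = D1 \/ D = D2) ->
  ((is_path ends1 ends2 D1 && is_path ends1 ends2 D2) ->
     forall f, f \in D1 :|: D2 -> pos_battery ends1 ends2 sigma f) /\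
  (~~ (is_path ends1 ends2 D1 && is_path ends1 ends2 D2) ->
     forall f, f \in D1 :|: D2 -> ~~ pos_battery ends1 ends2 sigma f).
Proof.
move=> block _ _ batC D12 bridges.
have b1 : is_bridge ends1 ends2 C D1 by apply/bridges; left.
have b2 : is_bridge ends1 ends2 C D2 by apply/bridges; right.
have D21 : D2 != D1 by rewrite eq_sym.
have cov g : g \notin C -> g \in D1 \/ g \in D2.
  by move=> /(bridge_cover block batC)[D /bridges[]-> gD]; [left | right].
(* Both lemmas concern an edge of the first bridge; the second one is reached by exchanging [D1] and
   [D2]. *)
split=> [/andP[p1 p2] f /setUP[fD|fD]|np f /setUP[fD|fD]].
- exact: (two_paths_battery block batC b1 b2).
- by apply: (two_paths_battery block batC b2 b1) => // g /cov[]; [right | left].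
- exact: (nonpath_not_battery block batC b1 b2).
- by apply: (nonpath_not_battery block batC b2 b1) => //; rewrite andbC.
Qed.
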